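(* The following matrices $A,B,C,D$ in $SL(2,\mathbb{F}_2(x,y))$ generate a faithful representation of the genus 2 surface group, where we have $ABA^{-1}B^{-1}=DCD^{-1}C^{-1}$: \[A=\begin{pmatrix} \frac{x^8+x^7+x^5+x^4+x^3}{x^6+x^5+1}&\frac{x^{13}+x^{11}+x^2+x+1}{(x^6+x^5+1)(x^5+1)(x^2+x+1)}\\ 1&\frac{x^3}{(x^5+1)(x^2+x+1)}\end{pmatrix},\] \[B=\begin{pmatrix} \frac{x^8+x^7+x^2}{(x^7+x^2+1)(x^5+1)}&\frac{x^{12}+x^{10}+x^9+x^5+x^4+x^2+1}{(x^7+x^2+1)(x^5+1)(x^2+x+1)}\\ x^2+x+1&x^2\end{pmatrix},\] and $D=TAT^{-1}$, $C=TBT^{-1}$ are the conjugates of $A,B$ respectively by $T=\mathrm{diag}(1,y)$. That is, the assignment $a\mapsto A$, $b\mapsto B$, $c\mapsto C$, $d\mapsto D$ defines an injective homomorphism from $S_2=\langle a,b,c,d\mid aba^{-1}b^{-1}=dcd^{-1}c^{-1}\rangle$ to $SL(2,\mathbb{F}_2(x,y))$.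
   Context: $S_2$ denotes the fundamental group of the closed orientable surface of genus 2, with presentation $\langle a,b,c,d\mid aba^{-1}b^{-1}=dcd^{-1}c^{-1}\rangle$. $\mathbb{F}_2(x,y)$ is the field of rational functions over the field with 2 elements in two algebraically independent variables $x,y$. *)

(* Defs.v *)
From HB Require Import structures.
From mathcomp Require Import all_boot all_order all_algebra.
From mathcomp Require Import boolp.

Set Implicit Arguments.
Unset Strict Implicit.
Unset Printing Implicit Defensive.

Import GRing.Theory.
Local Open Scope ring_scope.
Local Open Scope quotient_scope.

(** Groups given by generators and relations, as quotients of words.  The letter [(i, false)]
    stands for the generator [i], and [(i, true)] for its formal inverse. *)

Notation letter I := (I * bool)%type (only parsing).
Notation word I := (seq (I * bool)%type) (only parsing).

Definition letterV (I : Type) (s : letter I) : letter I := (s.1, ~~ s.2).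
Definition wordV (I : Type) (w : word I) : word I := rev (map (@letterV I) w).

(** A presentation is a list [rels] of pairs [(l, r)], read as equations
    [l = r] between words. *)
Inductive pres_cong (I : choiceType) (rels : seq (word I * word I)) :
  word I -> word I -> Prop :=
| pres_refl u : pres_cong rels u u
| pres_sym u v : pres_cong rels u v -> pres_cong rels v u
| pres_trans u v w :
    pres_cong rels u v -> pres_cong rels v w -> pres_cong rels u w
| pres_cat u u' v v' :
    pres_cong rels u u' -> pres_cong rels v v' ->
    pres_cong rels (u ++ v) (u' ++ v')
| pres_cancel (s : letter I) : pres_cong rels [:: s; letterV s] [::]
| pres_rel (l r : word I) : (l, r) \in rels -> pres_cong rels l r.

Section PresentedGroup.
Variables (I : choiceType) (rels : seq (word I * word I)).

Local Notation W := (word I).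

Definition pres_eqb : rel W := fun u v => `[< pres_cong rels u v >].

Lemma pres_eqb_refl : reflexive pres_eqb.
Proof. by move=> u; apply/asboolP; apply: pres_refl. Qed.

Lemma pres_eqb_sym : symmetric pres_eqb.
Proof. by move=> u v; apply/asboolP/asboolP; apply: pres_sym. Qed.

Lemma pres_eqb_trans : transitive pres_eqb.
Proof.
by move=> v u w /asboolP uv /asboolP vw; apply/asboolP; apply: pres_trans uv vw.
Qed.

Canonical pres_equiv :=
  EquivRel pres_eqb pres_eqb_refl pres_eqb_sym pres_eqb_trans.

Definition presented := {eq_quot pres_equiv}.

HB.instance Definition _ := Choice.on presented.
HB.instance Definition _ := EqQuotient.on presented.

Lemma pres_piP (u v : W) :
  pres_cong rels u v <-> \pi_presented u = \pi_presented v.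
Proof.
by split=> [uv|/eqmodP/asboolP//]; apply/eqmodP/asboolP.
Qed.

Lemma pres_repr (u : W) : pres_cong rels (repr (\pi_presented u)) u.
Proof. by apply/pres_piP; rewrite reprK. Qed.

Lemma letterVK : involutive (@letterV I).
Proof. by case=> i b; rewrite /letterV /= negbK. Qed.

Lemma wordVK : involutive (@wordV I).
Proof. by move=> u; rewrite /wordV map_rev revK mapK //; apply: letterVK. Qed.

Lemma wordV_cat (u v : W) : wordV (u ++ v) = wordV v ++ wordV u.
Proof. by rewrite /wordV map_cat rev_cat. Qed.

Lemma pres_mulV (u : W) : pres_cong rels (u ++ wordV u) [::].
Proof.
elim: u => [|s u IHu]; first exact: pres_refl.
rewrite -cat1s wordV_cat -catA [u ++ _ ++ _]catA.
apply: (pres_trans (v := [:: s] ++ ([::] ++ wordV [:: s]))).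
  by do 2![apply: pres_cat; rewrite //; try exact: pres_refl].
exact: pres_cancel.
Qed.

Lemma pres_Vmul (u : W) : pres_cong rels (wordV u ++ u) [::].
Proof. by rewrite -{2}[u]wordVK; apply: pres_mulV. Qed.

Lemma pres_congV (u v : W) :
  pres_cong rels u v -> pres_cong rels (wordV u) (wordV v).
Proof.
move=> uv; apply: (pres_trans (v := wordV u ++ (v ++ wordV v))).
  rewrite -[X in pres_cong _ X _]cats0.
  by apply: pres_cat; [apply: pres_refl | apply/pres_sym/pres_mulV].
rewrite catA -[X in pres_cong _ _ X]cat0s.
apply: pres_cat; last exact: pres_refl.
apply: (pres_trans (v := wordV u ++ u)); last exact: pres_Vmul.
by apply: pres_cat; [apply: pres_refl | apply: pres_sym].
Qed.

Definition pres_one : presented := \pi_presented [::].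
Definition pres_mul (g h : presented) : presented :=
  \pi_presented (repr g ++ repr h).
Definition pres_inv (g : presented) : presented :=
  \pi_presented (wordV (repr g)).

Lemma pi_presM (u v : W) :
  \pi_presented (u ++ v) = pres_mul (\pi_presented u) (\pi_presented v).
Proof. by apply/pres_piP/pres_cat; apply/pres_sym/pres_repr. Qed.

Lemma pi_presV (u : W) :
  \pi_presented (wordV u) = pres_inv (\pi_presented u).
Proof. by apply/pres_piP/pres_congV/pres_sym/pres_repr. Qed.

Lemma presP (g : presented) : {u : W | g = \pi_presented u}.
Proof. by exists (repr g); rewrite reprK. Qed.

Lemma pres_mulA : associative pres_mul.
Proof.
move=> g h k; have [u ->] := presP g; have [v ->] := presP h.
have [w ->] := presP k.
by rewrite -!pi_presM catA.
Qed.

Lemma pres_mul1g : left_id pres_one pres_mul.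
Proof. by move=> g; have [u ->] := presP g; rewrite -pi_presM. Qed.

Lemma pres_mulg1 : right_id pres_one pres_mul.
Proof. by move=> g; have [u ->] := presP g; rewrite -pi_presM cats0. Qed.

Lemma pres_mulVg : left_inverse pres_one pres_inv pres_mul.
Proof.
move=> g; have [u ->] := presP g.
by rewrite -pi_presV -pi_presM; apply/pres_piP/pres_Vmul.
Qed.

Lemma pres_mulgV : right_inverse pres_one pres_inv pres_mul.
Proof.
move=> g; have [u ->] := presP g.
by rewrite -pi_presV -pi_presM; apply/pres_piP/pres_mulV.
Qed.

HB.instance Definition _ := isGroup.Build presented
  pres_mulA pres_mul1g pres_mulg1 pres_mulVg pres_mulgV.

Definition pres_gen (i : I) : presented := \pi_presented [:: (i, false)].

End PresentedGroup.

(** The genus 2 surface group < a, b, c, d | a b a^-1 b^-1 = d c d^-1 c^-1 >. *)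

Definition ga : 'I_4 := inord 0.
Definition gb : 'I_4 := inord 1.
Definition gc : 'I_4 := inord 2.
Definition gd : 'I_4 := inord 3.

Definition S2_rel : word 'I_4 * word 'I_4 :=
  ([:: (ga, false); (gb, false); (ga, true); (gb, true)],
   [:: (gd, false); (gc, false); (gd, true); (gc, true)]).

Definition S2 := presented [:: S2_rel].
HB.instance Definition _ := Group.on S2.

Definition S2a : S2 := pres_gen _ ga.
Definition S2b : S2 := pres_gen _ gb.
Definition S2c : S2 := pres_gen _ gc.
Definition S2d : S2 := pres_gen _ gd.

(** The special linear group as a (possibly infinite) abstract group: the
    library's ['GL_n[R]] requires a finite ring. *)

Section SpecialLinear.
Variables (n : nat) (R : comUnitRingType).

Record SL : Type := MkSL { SLval : 'M[R]_n; SLvalP : \det SLval == 1 }.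

HB.instance Definition _ := [isSub for SLval].
HB.instance Definition _ := [Choice of SL by <:].

Lemma SL_unit (A : SL) : SLval A \in unitmx.
Proof. by rewrite unitmxE (eqP (SLvalP A)) unitr1. Qed.

Lemma SL_one_subproof : \det (1%:M : 'M[R]_n) == 1.
Proof. by rewrite det1. Qed.

Lemma SL_mul_subproof (A B : SL) : \det (SLval A *m SLval B) == 1.
Proof. by rewrite det_mulmx (eqP (SLvalP A)) (eqP (SLvalP B)) mulr1. Qed.

Lemma SL_inv_subproof (A : SL) : \det (invmx (SLval A)) == 1.
Proof. by rewrite det_inv (eqP (SLvalP A)) invr1. Qed.

Definition SL_one : SL := MkSL SL_one_subproof.
Definition SL_mul (A B : SL) : SL := MkSL (SL_mul_subproof A B).
Definition SL_inv (A : SL) : SL := MkSL (SL_inv_subproof A).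

Lemma SL_mulA : associative SL_mul.
Proof. by move=> A B C; apply: val_inj; rewrite /= mulmxA. Qed.

Lemma SL_mul1g : left_id SL_one SL_mul.
Proof. by move=> A; apply: val_inj; rewrite /= mul1mx. Qed.

Lemma SL_mulg1 : right_id SL_one SL_mul.
Proof. by move=> A; apply: val_inj; rewrite /= mulmx1. Qed.

Lemma SL_mulVg : left_inverse SL_one SL_inv SL_mul.
Proof. by move=> A; apply: val_inj; rewrite /= mulVmx ?SL_unit. Qed.

Lemma SL_mulgV : right_inverse SL_one SL_inv SL_mul.
Proof. by move=> A; apply: val_inj; rewrite /= mulmxV ?SL_unit. Qed.

HB.instance Definition _ := isGroup.Build SL
  SL_mulA SL_mul1g SL_mulg1 SL_mulVg SL_mulgV.

End SpecialLinear.

(** F_2(x,y) is the fraction field of F_2[x][y]: the inner variable is x. *)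

Definition F2xy : fieldType := {fraction {poly {poly 'F_2}}}.

Definition rx : F2xy := FracField.tofrac ('X%:P : {poly {poly 'F_2}}).
Definition ry : F2xy := FracField.tofrac ('X : {poly {poly 'F_2}}).

Definition mx2 (R : Type) (p q r s : R) : 'M[R]_2 :=
  \matrix_(i < 2, j < 2)
    if i == 0 then (if j == 0 then p else q) else (if j == 0 then r else s).

Definition matA : 'M[F2xy]_2 :=
  let x := rx in
  mx2
    ((x ^+ 8 + x ^+ 7 + x ^+ 5 + x ^+ 4 + x ^+ 3) / (x ^+ 6 + x ^+ 5 + 1))
    ((x ^+ 13 + x ^+ 11 + x ^+ 2 + x + 1)
       / ((x ^+ 6 + x ^+ 5 + 1) * (x ^+ 5 + 1) * (x ^+ 2 + x + 1)))
    1
    (x ^+ 3 / ((x ^+ 5 + 1) * (x ^+ 2 + x + 1))).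

Definition matB : 'M[F2xy]_2 :=
  let x := rx in
  mx2
    ((x ^+ 8 + x ^+ 7 + x ^+ 2) / ((x ^+ 7 + x ^+ 2 + 1) * (x ^+ 5 + 1)))
    ((x ^+ 12 + x ^+ 10 + x ^+ 9 + x ^+ 5 + x ^+ 4 + x ^+ 2 + 1)
       / ((x ^+ 7 + x ^+ 2 + 1) * (x ^+ 5 + 1) * (x ^+ 2 + x + 1)))
    (x ^+ 2 + x + 1)
    (x ^+ 2).

Definition matT : 'M[F2xy]_2 := mx2 1 0 0 ry.

Definition matD : 'M[F2xy]_2 := matT *m matA *m invmx matT.
Definition matC : 'M[F2xy]_2 := matT *m matB *m invmx matT.

(* Main.v *)
(** Over F_2(x), valued by the degree in x, the Moebius maps of A and B play
    ping-pong on the projective line.  With z = v1 / v2, the four regions are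
      a: deg z >= 2,   a^-1: deg z = -2,   b: deg z <= -4,   b^-1: deg z = 0,
    and each letter sends the complement of the region of its inverse into its
    own region.  The commutator [A, B] is diagonal, so infinity and 0 have the
    periodic itineraries (a b a^-1 b^-1)^oo and (b a b^-1 a^-1)^oo; comparing
    itineraries, a word in a, b fixing infinity or 0 is a power of the
    commutator.  Hence a word in a, b that is not a power of the commutator has
    both off-diagonal entries nonzero.

    Since T commutes with [A, B], the representation is defined on the
    amalgam S_2 = <a, b> *_[a,b]=[d,c] <d, c>.  An element outside the
    amalgamated cyclic group is an alternating product of syllables with nonzero
    off-diagonal entries, and its matrix has an entry of positive degree in y. *)

From HB Require Import structures.
Require Import Defs.
From mathcomp Require Import all_boot all_order all_algebra.
From mathcomp Require Import zify.

Set Implicit Arguments.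
Unset Strict Implicit.
Unset Printing Implicit Defensive.

Import GRing.Theory.
Local Open Scope ring_scope.

(** * Sparse polynomials over F_2 and 2 x 2 matrices *)

(** Exponents may repeat, and repetitions cancel modulo 2. Sums and products thus become plain list
    operations, and simplification is postponed to [eq_sp]. *)
Definition sp (s : seq nat) : {poly 'F_2} := \sum_(i <- s) 'X^i.

Lemma sp0 : sp [::] = 0.
Proof. exact: big_nil. Qed.

Lemma spD s t : sp s + sp t = sp (s ++ t).
Proof. by rewrite /sp big_cat. Qed.

Lemma spM s t : sp s * sp t = sp [seq (i + j)%N | i <- s, j <- t].
Proof.
rewrite /sp mulr_suml big_allpairs_dep /=; apply: eq_bigr => i _.
by rewrite mulr_sumr; apply: eq_bigr => j _; rewrite exprD.
Qed.

Lemma coef_sp s i : (sp s)`_i = (count_mem i s)%:R.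
Proof.
elim: s => [|j s IHs]; first by rewrite /sp big_nil coef0.
by rewrite /sp big_cons coefD -/(sp s) IHs coefXn /= natrD eq_sym.
Qed.

Lemma natrF2 n : n%:R = (odd n)%:R :> 'F_2.
Proof. by apply: val_inj; rewrite /= !val_Fp_nat // modn2; case: odd. Qed.

(** The coefficient at [i] is the parity of the multiplicity of [i], so a bound [n] on all exponents
    turns a polynomial identity into a finite boolean check. *)
Lemma eq_sp n s t :
    all (gtn n) s && all (gtn n) t
      && all (fun i => odd (count_mem i s) == odd (count_mem i t)) (iota 0 n) ->
  sp s = sp t.
Proof.
case/andP=> /andP[sn tn] /allP eq_st; apply/polyP=> i.
rewrite !coef_sp natrF2 [RHS]natrF2; have [lt_in|le_ni] := ltnP i n.
  by rewrite (eqP (eq_st i _)) // mem_iota.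
have noti r : all (gtn n) r -> count_mem i r = 0%N.
  move=> /allP rn; apply/count_memPn/negP=> /rn /=; lia.
by rewrite !noti.
Qed.

Lemma size_sp n s : all (gtn n) s -> size (sp (n :: s)) = n.+1.
Proof.
move=> /allP sn; rewrite /sp big_cons size_polyDl ?size_polyXn // ltnS.
rewrite big_seq_cond (leq_trans (size_sum _ _ _)) //.
by apply/bigmax_leqP_seq=> i si _; rewrite size_polyXn; apply: sn.
Qed.

Lemma oppF2 (p : {poly 'F_2}) : - p = p.
Proof.
by apply/polyP=> i; rewrite coefN; apply: val_inj; case: (p`_i) => [[|[]]].
Qed.

Lemma ord2P (i : 'I_2) : i = 0 \/ i = 1.
Proof. by case: i => [[|[]]] // ?; [left | right]; apply: val_inj. Qed.

Section Mx2.
Variable R : comNzRingType.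
Implicit Types (p q r s : R) (v : 'cV[R]_2).

Lemma mx2_mul p q r s p' q' r' s' :
  mx2 p q r s *m mx2 p' q' r' s' =
  mx2 (p * p' + q * r') (p * q' + q * s') (r * p' + s * r') (r * q' + s * s').
Proof.
apply/matrixP=> i j; rewrite !mxE !big_ord_recl big_ord0 addr0 !mxE /=.
by case: (i == 0); case: (j == 0).
Qed.

Lemma mx2_scalar p : p%:M = mx2 p 0 0 p.
Proof.
by apply/matrixP=> i j; rewrite !mxE; case: (ord2P i) (ord2P j) => -> [] ->.
Qed.

Lemma mx2E (M : 'M[R]_2) : M = mx2 (M 0 0) (M 0 1) (M 1 0) (M 1 1).
Proof.
by apply/matrixP=> i j; rewrite !mxE; case: (ord2P i) (ord2P j) => -> [] ->.
Qed.

Lemma mx2_scale c p q r s : c *: mx2 p q r s = mx2 (c * p) (c * q) (c * r) (c * s).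
Proof. by apply/matrixP=> i j; rewrite !mxE; do 2!case: ifP. Qed.

Lemma mulmx2_v0 (M : 'M[R]_2) v : (M *m v) 0 0 = M 0 0 * v 0 0 + M 0 1 * v 1 0.
Proof.
rewrite !mxE !big_ord_recl big_ord0 addr0.
by congr (_ + M _ _ * v _ _); apply: val_inj.
Qed.

Lemma mulmx2_v1 (M : 'M[R]_2) v : (M *m v) 1 0 = M 1 0 * v 0 0 + M 1 1 * v 1 0.
Proof.
rewrite !mxE !big_ord_recl big_ord0 addr0.
by congr (_ + M _ _ * v _ _); apply: val_inj.
Qed.

Lemma det_mx2_eq p q r s : \det (mx2 p q r s) = p * s - q * r.
Proof.
rewrite (expand_det_row _ 0) !big_ord_recl big_ord0 addr0 /cofactor !det_mx11.
by rewrite !mxE /= expr0 expr1 mul1r mulN1r mulrN.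
Qed.

End Mx2.

Lemma map_mx2 (R S : Type) (f : R -> S) p q r s :
  map_mx f (mx2 p q r s) = mx2 (f p) (f q) (f r) (f s).
Proof. by apply/matrixP=> i j; rewrite !mxE; do 2!case: ifP. Qed.

(** * Words and the matrices of [A] and [B] without denominators *)

Definition ev (G : groupType) (I : Type) (f : I -> G) (w : word I) : G :=
  foldr (fun s g => ((if s.2 then (f s.1)^-1 else f s.1) * g)%g) 1%g w.

Section Eval.
Variables (G : groupType) (I : Type) (f : I -> G).
Local Open Scope group_scope.

Lemma ev1 s : ev f [:: s] = if s.2 then (f s.1)^-1 else f s.1.
Proof. exact: mulg1. Qed.

Lemma ev_cat u v : ev f (u ++ v) = ev f u * ev f v.
Proof. by elim: u => [|s u IHu] /=; rewrite ?mul1g // IHu mulgA. Qed.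

Lemma ev_cons s u : ev f (s :: u) = ev f [:: s] * ev f u.
Proof. by rewrite -cat1s ev_cat. Qed.

Lemma ev_letterV s : ev f [:: letterV s] = (ev f [:: s])^-1.
Proof. by case: s => i []; rewrite /= !mulg1 ?invgK. Qed.

Lemma ev_cancel u s v : ev f (u ++ s :: letterV s :: v) = ev f (u ++ v).
Proof.
by rewrite !ev_cat (ev_cons s) (ev_cons _ v) ev_letterV mulVKg.
Qed.

End Eval.

Section Reduced.
Variable I : eqType.
Implicit Types (s : letter I) (u : word I).

Definition red_rel : rel (letter I) := fun s t => t != letterV s.

(** Takes the place of free reduction: a word that is not reduced is shortened by one cancelling
    pair inside an induction on length. *)
Lemma sorted_or_cancel u :
  sorted red_rel u \/ exists u1 s u2, u = u1 ++ s :: letterV s :: u2.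
Proof.
elim: u => [|s [|t u] IHu]; try by left.
have [->|ts] := eqVneq t (letterV s); first by right; exists [::], s, u.
case: IHu => [red_tu|[u1 [s' [u2 ->]]]]; last by right; exists (s :: u1), s', u2.
by left; rewrite /= [red_rel _ _]ts.
Qed.

End Reduced.

(* [matA] and [matB] multiplied by the common denominators [letter_den] of
   their entries. *)
Definition At : 'M[{poly 'F_2}]_2 :=
  mx2 (sp [:: 15; 8; 5; 3]%N)
      (sp [:: 13; 11; 2; 1; 0]%N)
      (sp [:: 13; 10; 8; 7; 6; 2; 1; 0]%N)
      (sp [:: 9; 8; 3]%N).
Definition Bt : 'M[{poly 'F_2}]_2 :=
  mx2 (sp [:: 10; 7; 4; 3; 2]%N)
      (sp [:: 12; 10; 9; 5; 4; 2; 0]%N)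
      (sp [:: 16; 14; 12; 9; 7; 6; 5; 0]%N)
      (sp [:: 16; 15; 14; 9; 8; 7; 6; 5; 3; 2]%N).

(** An inverse letter gets the adjugate of [M], which carries no signs in characteristic 2; as the
    generators have determinant 1, it is the inverse multiplied by the same denominator. *)
Definition letter_mx (s : letter bool) : 'M[{poly 'F_2}]_2 :=
  let M := if s.1 then Bt else At in
  if s.2 then mx2 (M 1 1) (M 0 1) (M 1 0) (M 0 0) else M.

Definition letter_den (i : bool) : {poly 'F_2} :=
  if i then sp [:: 14; 13; 12; 7; 6; 5; 4; 3; 1; 0]%N else sp [:: 13; 10; 8; 7; 6; 2; 1; 0]%N.

Definition word_mx (u : word bool) : 'M[{poly 'F_2}]_2 :=
  foldr (fun s M => letter_mx s *m M) 1%:M u.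

Lemma word_mx_cat u v : word_mx (u ++ v) = word_mx u *m word_mx v.
Proof. by elim: u => [|s u IHu] /=; rewrite ?mul1mx // IHu mulmxA. Qed.

Lemma letter_mxV s : letter_mx s *m letter_mx (letterV s) = (letter_den s.1 ^+ 2)%:M.
Proof.
case: s => [[] []]; rewrite /letter_mx /letter_den /= /At /Bt !mxE /=.
all: rewrite mx2_mul mx2_scalar -!sp0 expr2 !spM !spD.
all: by congr mx2; apply: (@eq_sp 40); vm_compute.
Qed.

(** * Ping-pong in the degree of [x] *)

Lemma size_mulE (R : idomainType) (p q : {poly R}) :
  size (p * q) =
  (if (size p == 0)%N || (size q == 0)%N then 0%N else (size p + size q).-1).
Proof.
rewrite !size_poly_eq0; have [->|p0] := eqVneq p; first by rewrite mul0r size_poly0.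
have [->|q0] := eqVneq q; first by rewrite mulr0 size_poly0.
exact: size_mul.
Qed.

(** The ultrametric inequality, in a form that [lia] can use once sizes are generalized to numbers;
    nothing is claimed about a tie beyond the upper bound. *)
Lemma size_add_cases (R : nzRingType) (p q : {poly R}) :
  [/\ size (p + q)%R <= maxn (size p) (size q),
      size p < size q -> size (p + q)%R = size q
    & size q < size p -> size (p + q)%R = size p]%N.
Proof.
split; first exact: size_polyD; last exact: size_polyDl.
by rewrite addrC; apply: size_polyDl.
Qed.

(** Here [m] and [n] are the sizes of the two coordinates, so deg z is [m - n] when both are
    nonzero. Size 0 means a zero coordinate: [n == 0] puts infinity in the region of a, and [m == 0]
    puts 0 in that of b. *)
Definition region (s : letter bool) (m n : nat) : bool :=
  match s with
  | (false, false) => (0 < m) && ((n == 0) || (n + 2 <= m))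
  | (false, true) => (0 < m) && (n == m + 2)
  | (true, false) => (0 < n) && ((m == 0) || (m + 4 <= n))
  | (true, true) => (0 < m) && (m == n)
  end%N.

Definition in_region s (v : 'cV[{poly 'F_2}]_2) :=
  region s (size (v 0 0)) (size (v 1 0)).

Lemma cV2P (T : Type) (v w : 'cV[T]_2) : v 0 0 = w 0 0 -> v 1 0 = w 1 0 -> v = w.
Proof.
move=> eq0 eq1; apply/colP=> i.
by case: (ord2P i) => ->.
Qed.

Lemma cV2_eq0 (R : nmodType) (v : 'cV[R]_2) : (v == 0) = (v 0 0 == 0) && (v 1 0 == 0).
Proof.
apply/eqP/andP=> [->|[/eqP v0 /eqP v1]]; first by rewrite !mxE.
by apply: cV2P; rewrite ?v0 ?v1 mxE.
Qed.

Lemma region_disjoint s t m n : region s m n -> region t m n -> s = t.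
Proof. by case: s t => [[] []] [[] []] //=; lia. Qed.

Lemma region_neq0 s v : in_region s v -> v != 0.
Proof.
rewrite /in_region cV2_eq0 -!size_poly_eq0.
by move: (size (v 0 0)) (size (v 1 0)) => m n; case: s => [[] []] /=; lia.
Qed.

Lemma in_region_scale (c : {poly 'F_2}) s v :
  c != 0 -> in_region s (c *: v) = in_region s v.
Proof.
rewrite /in_region !mxE !size_mulE -size_poly_eq0.
move: (size c) (size (v 0 0)) (size (v 1 0)) => l m n l0.
rewrite (negPf l0) /=.
by case: s => [[] []]; case: (m =P 0%N) => ?; case: (n =P 0%N) => ? /=; lia.
Qed.

(** Write d for deg z. For a, the numerator terms have degrees d + 15 and 13, which tie only at the
    excluded d = -2; a tie in the denominator, at d = -4, can only push the image deeper into its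
    region. For b, the denominator ties only at the excluded d = 0, and the numerator tie at d = 2
    is harmless in the same way. For the inverse letters no tie occurs outside the excluded
    region. *)
Lemma ping_pong s v : v != 0 -> ~~ in_region (letterV s) v -> in_region s (letter_mx s *m v).
Proof.
rewrite cV2_eq0 -!size_poly_eq0 /in_region mulmx2_v0 mulmx2_v1.
have [] := size_add_cases (letter_mx s 0 0 * v 0 0) (letter_mx s 0 1 * v 1 0).
have [] := size_add_cases (letter_mx s 1 0 * v 0 0) (letter_mx s 1 1 * v 1 0).
move: (size (_ * _ + _ * _ : {poly 'F_2})) => y.
move: (size (_ * _ + _ * _ : {poly 'F_2})) => x.
rewrite !size_mulE; move: (size (v 0 0)) (size (v 1 0)) => m n.
case: s => [[] []]; rewrite /letter_mx /=.
all: rewrite !mxE /= !size_sp //=.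
all: case: (m =P 0%N) => ?; case: (n =P 0%N) => ? /=.
all: lia.
Qed.

(** * Itineraries *)

Lemma letter_den_neq0 i : letter_den i != 0.
Proof. by rewrite -size_poly_eq0; case: i; rewrite size_sp. Qed.

(** In a reduced word, the region reached by each letter is disjoint from the one region that the
    next letter to act must avoid. *)
Lemma path_ping s u v :
    v != 0 -> path (@red_rel _) s u ->
    ~~ in_region (letterV (last s u)) v ->
  in_region s (word_mx (s :: u) *m v).
Proof.
move=> v0; elim: u s => [|t u IHu] s /=.
  by move=> _; rewrite mulmx1; apply: ping_pong.
case/andP=> ts red_u /(IHu _ red_u) in_t; rewrite -mulmxA.
apply: ping_pong; first exact: region_neq0 in_t.
by apply/negP=> /(region_disjoint in_t) /eqP; apply/negP.
Qed.

(** For nonzero vectors this is equality of points of the projective line over F_2(x), with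
    denominators cleared. *)
Definition par (v w : 'cV[{poly 'F_2}]_2) :=
  exists a b, [/\ a != 0, b != 0 & a *: v = b *: w].

Lemma par_refl v : par v v.
Proof. by exists 1, 1; rewrite oner_eq0. Qed.

Lemma par_sym v w : par v w -> par w v.
Proof. by case=> a [b [a0 b0 eq_vw]]; exists b, a. Qed.

Lemma par_trans w v x : par v w -> par w x -> par v x.
Proof.
case=> a [b [a0 b0 vw]] [c [d [c0 d0 wx]]]; exists (c * a), (b * d).
by rewrite !mulf_neq0 // -!scalerA vw -wx !scalerA mulrC.
Qed.

Lemma par_mul (M : 'M_2) v w : par v w -> par (M *m v) (M *m w).
Proof.
by case=> a [b [a0 b0 vw]]; exists a, b; rewrite !scalemxAr vw.
Qed.

Lemma par_scale c v : c != 0 -> par (c *: v) v.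
Proof. by move=> c0; exists 1, c; rewrite oner_eq0 c0 scale1r. Qed.

Lemma par_letterV s v : par (letter_mx s *m (letter_mx (letterV s) *m v)) v.
Proof.
by rewrite mulmxA letter_mxV mul_scalar_mx; apply/par_scale/expf_neq0/letter_den_neq0.
Qed.

Lemma par_in_region s v w : par v w -> in_region s v = in_region s w.
Proof.
by case=> a [b [a0 b0 vw]]; rewrite -(in_region_scale _ _ a0) vw in_region_scale.
Qed.

Lemma par_mulV s v w :
  par (letter_mx s *m v) w -> par v (letter_mx (letterV s) *m w).
Proof.
move/(par_mul (letter_mx (letterV s))); apply: par_trans; apply: par_sym.
by have := par_letterV (letterV s) v; rewrite letterVK.
Qed.

Section Itinerary.
Variables (G : groupType) (f : bool -> G).
(** The letters [e] spell an itinerary and [p] lists its tails: up to scalars, [p 0] is the image of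
    [p n] under the product of [e 0], ..., [e n.-1]. *)
Variables (e : nat -> letter bool) (p : nat -> 'cV[{poly 'F_2}]_2).
Hypothesis e_eq : forall i j, e i = e j <-> i = j %[mod 4].
Hypothesis e_region : forall i, in_region (e i) (p i).
Hypothesis e_step : forall i, par (letter_mx (e i) *m p i.+1) (p i).

Lemma e_stepV i : par (letter_mx (letterV (e i)) *m p i) (p i.+1).
Proof. exact/par_sym/par_mulV/e_step. Qed.

Local Notation P n := (ev f (mkseq e n)).

Lemma ev_itinS n : P n.+1 = (P n * ev f [:: e n])%g.
Proof. by rewrite -ev_cat cats1 -mkseqS. Qed.

(** The word [u] must read off a segment of the itinerary starting at [j], then undo one starting at
    [i]: with [P n] the prefix of length [n], these are [P j^-1 P k] and [P l^-1 P i]. Since [G] is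
    arbitrary, the conclusion is later read directly in [S2]. *)
Lemma itinerary u i j : par (word_mx u *m p i) (p j) ->
  exists k l, k = l %[mod 4] /\ ev f u = ((P j)^-1 * P k * ((P l)^-1 * P i))%g.
Proof.
have [n] := ubnP (size u); elim: n => // n IHn in u i j *.
move=> le_un ui_j.
have [red_u|[u1 [s [u2 def_u]]]] := sorted_or_cancel u; last first.
  have lt_u : (size (u1 ++ u2) < n)%N.
    by move: le_un; rewrite def_u !size_cat /=; lia.
  rewrite def_u ev_cancel; apply: (IHn _ i j lt_u).
  apply: par_trans ui_j; rewrite def_u !word_mx_cat /= -!mulmxA.
  exact/par_mul/par_sym/par_letterV.
case: u => [|s u] in red_u le_un ui_j *.
  exists j, i; split; last by rewrite mulVg mulVg mulg1.
  move: ui_j; rewrite /= mul1mx => /(par_in_region (e i)).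
  by rewrite e_region => /esym /region_disjoint/(_ (e_region j)) /e_eq.
(* If the first letter follows the itinerary of [p j], strip it and advance [j]. *)
have [def_s|s_neq] := eqVneq s (e j).
  have /(IHn u i j.+1 le_un)[k [l [eq_kl ev_u]]] : par (word_mx u *m p i) (p j.+1).
    apply: par_trans (e_stepV j); rewrite -def_s; apply: par_mulV.
    by rewrite mulmxA.
  exists k, l; split=> //; rewrite ev_cons ev_u ev_itinS -def_s.
  by move: (ev f [:: s]) => x; rewrite invgM !mulgA mulgV mul1g.
(* If the last letter undoes the first step of the itinerary of [p i], strip it and advance [i]. *)
have [def_t|t_neq] := eqVneq (last s u) (letterV (e i)).
  move: le_un ui_j; rewrite lastI size_rcons -cats1 word_mx_cat ev_cat def_t.
  rewrite [word_mx [:: _]]mulmx1 -mulmxA => le_un ui_j.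
  have /(IHn _ i.+1 j le_un)[k [l [eq_kl ->]]] :
      par (word_mx (belast s u) *m p i.+1) (p j).
    by apply: par_trans ui_j; apply/par_mul/par_sym/e_stepV.
  exists k, l; split=> //; rewrite ev_letterV ev_itinS.
  by move: (ev f [:: e i]) => x; rewrite !mulgA mulgK.
(* Nothing can be stripped: ping-pong puts the image in the region of [s], whereas [p j] lies in
   that of [e j], a contradiction. *)
have := path_ping (region_neq0 (e_region i)) red_u.
rewrite (par_in_region _ ui_j) => in_s.
suffices /in_s /region_disjoint /(_ (e_region j)) /eqP: ~~ in_region (letterV (last s u)) (p i).
  by rewrite (negPf s_neq).
apply: contra t_neq => /region_disjoint /(_ (e_region i)) <-.
by rewrite letterVK.
Qed.

Hypothesis e_per : forall i, e (i + 4) = e i.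

Lemma ev_itin_mod n m : ev f (mkseq e (m * 4 + n)) = (P 4 ^+ m * P n)%g.
Proof.
elim: m => [|m IHm]; first by rewrite mul1g.
rewrite mulSn -addnA expgS -mulgA -IHm -ev_cat; congr ev.
rewrite /mkseq iotaD map_cat; congr (_ ++ _).
rewrite -[(0 + 4)%N]addn0 iotaDl -map_comp; apply: eq_map => i /=.
by rewrite addnC e_per.
Qed.

Lemma itinerary_cycle u : par (word_mx u *m p 0%N) (p 0%N) ->
  exists k l, ev f u = (P 4 ^+ k / P 4 ^+ l)%g.
Proof.
case/itinerary=> k [l [eq_kl ->]]; exists (k %/ 4)%N, (l %/ 4)%N.
(* As [k] and [l] agree modulo 4, their incomplete periods are equal and cancel, leaving whole
   periods. *)
rewrite /= invg1 mul1g mulg1 (divn_eq k 4) (divn_eq l 4) eq_kl !ev_itin_mod.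
by rewrite !divnMDl // ![(_ %% 4 %/ 4)%N]divn_small ?ltn_mod // !addn0 mulgKA.
Qed.

End Itinerary.

Definition cycle4 (T : Type) (x0 x1 x2 x3 : T) (i : nat) : T :=
  nth x0 [:: x0; x1; x2; x3] (i %% 4).

Lemma cycle4_eq (T : eqType) (x0 x1 x2 x3 : T) i j : uniq [:: x0; x1; x2; x3] ->
  cycle4 x0 x1 x2 x3 i = cycle4 x0 x1 x2 x3 j <-> i = j %[mod 4].
Proof.
move=> uniq_x; split=> [/eqP|eq_ij]; last by rewrite /cycle4 eq_ij.
by rewrite nth_uniq ?ltn_mod // => /eqP.
Qed.

(* A point fixed by a product of four distinct letters has the periodic
   itinerary spelled by these letters. *)
Lemma fixed_point_stab (G : groupType) (f : bool -> G) s0 s1 s2 s3 v u :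
    uniq [:: s0; s1; s2; s3] -> sorted (@red_rel _) [:: s0; s1; s2; s3] ->
    v != 0 -> ~~ in_region (letterV s3) v ->
    par (word_mx [:: s0; s1; s2; s3] *m v) v -> par (word_mx u *m v) v ->
  exists k l,
    ev f u = (ev f [:: s0; s1; s2; s3] ^+ k / ev f [:: s0; s1; s2; s3] ^+ l)%g.
Proof.
move=> uniq_s red_s v0 v_out wv uv.
pose e := cycle4 s0 s1 s2 s3.
pose p := cycle4 v (word_mx [:: s1; s2; s3] *m v) (word_mx [:: s2; s3] *m v)
  (word_mx [:: s3] *m v).
have mod4 i : exists2 r, (i %% 4 = r)%N & [\/ r = 0, r = 1, r = 2 | r = 3]%N.
  by exists (i %% 4)%N => //; have := ltn_pmod i (isT : 0 < 4)%N;
     case: (_ %% 4)%N => [|[|[|[|]]]] // _;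
     [constructor 1 | constructor 2 | constructor 3 | constructor 4].
have mod4S i : (i.+1 %% 4 = (i %% 4).+1 %% 4)%N by rewrite -addn1 -modnDml addn1.
have e_region i : in_region (e i) (p i).
  rewrite /e /p /cycle4; have [r ->] := mod4 i.
  case: (and4P red_s) => r01 r12 r23 _.
  case=> ->.
  (* The point [v] is itself the image of [v] under the whole period, which puts it in the region of
     [s0]. *)
  - by rewrite (par_in_region _ (par_sym wv)); apply: (@path_ping s0).
  - by apply: (@path_ping s1 [:: s2; s3]); rewrite //= r12 r23.
  - by apply: (@path_ping s2 [:: s3]); rewrite //= r23.
  - exact: (@path_ping s3 [::]).
have e_step i : par (letter_mx (e i) *m p i.+1) (p i).
  rewrite /e /p /cycle4 mod4S; have [r -> [] ->] := mod4 i.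
  - by apply: par_trans wv; rewrite /= -!mulmxA; apply: par_refl.
  - by rewrite /= -!mulmxA; apply: par_refl.
  - by rewrite /= -!mulmxA; apply: par_refl.
  - by rewrite /= mulmx1; apply: par_refl.
have e_eq i j : e i = e j <-> i = j %[mod 4] by apply: cycle4_eq.
have e_per i : e (i + 4)%N = e i by rewrite /e /cycle4 modnDr.
have [k [l ->]] := itinerary_cycle f e_eq e_region e_step e_per uv.
by exists k, l.
Qed.

(** * The commutator *)

Definition comm_word (i j : bool) : word bool :=
  [:: (i, false); (j, false); (i, true); (j, true)].

Lemma ev_comm_word (G : groupType) (f : bool -> G) i j :
  ev f (comm_word i j) = (f i * f j / f i / f j)%g.
Proof. by rewrite /ev /= mulg1 !mulgA. Qed.

(** With [comm_eig1], the eigenvalues of [A, B] multiplied by the squares of both denominators, of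
    total degree 54. The degrees 60 and 48 thus stand for 6 and -6. *)
Definition comm_eig0 : {poly 'F_2} :=
  sp [:: 60; 59; 56; 55; 54; 53; 51; 50; 49; 43; 42; 41; 38; 37; 35; 34; 33; 29; 28; 27;
      26; 23; 21; 19; 18; 17; 16; 11; 10; 8; 7; 6; 2; 0]%N.

Definition comm_eig1 : {poly 'F_2} :=
  sp [:: 48; 47; 46; 45; 44; 43; 40; 38; 34; 33; 31; 30; 27; 25; 21; 17; 16; 14; 12; 10; 7;
      4; 2; 0]%N.

Ltac sp_mx :=
  rewrite /letter_mx /At /Bt ?mxE /= mx2_mul !spM !spD; congr mx2;
  apply: (@eq_sp 64); vm_compute; reflexivity.

(** Stating the two half products in reduced form keeps the exponent lists short before the final
    multiplication. *)
Lemma comm_ab_mx : word_mx (comm_word false true) = mx2 comm_eig0 0 0 comm_eig1.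
Proof.
have AB : letter_mx (false, false) *m letter_mx (true, false) =
  mx2 (sp [:: 29; 25; 23; 18; 17; 16; 15; 13; 12; 11; 10; 9; 8; 7; 6; 2; 1; 0]%N)
    (sp [:: 29; 28; 27; 26; 24; 22; 21; 19; 16; 14; 13; 11; 8; 7; 3; 2]%N)
    (sp [:: 25; 24; 22; 21; 20; 19; 17; 16; 15; 13; 11; 10; 9; 7; 6; 4; 3; 2]%N)
    (sp [:: 23; 22; 19; 18; 15; 12; 11; 10; 9; 8; 5; 3; 1; 0]%N) by sp_mx.
have VV : letter_mx (false, true) *m letter_mx (true, true) =
  mx2 (sp [:: 29; 25; 23; 18; 17; 16; 15; 13; 12; 11; 10; 9; 8; 7; 6; 2; 1; 0]%N)
    (sp [:: 23; 19; 18; 16; 15; 12; 8; 6; 5; 4; 3; 2]%N)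
    (sp [:: 31; 28; 26; 25; 21; 18; 17; 16; 13; 12; 7; 5; 3; 2]%N)
    (sp [:: 23; 22; 19; 18; 15; 12; 11; 10; 9; 8; 5; 3; 1; 0]%N) by sp_mx.
rewrite /= mulmx1 mulmxA AB VV -sp0; sp_mx.
Qed.

Lemma comm_ba_mx : word_mx (comm_word true false) = mx2 comm_eig1 0 0 comm_eig0.
Proof.
have BA : letter_mx (true, false) *m letter_mx (false, false) =
  mx2 (sp [:: 23; 22; 19; 18; 15; 12; 11; 10; 9; 8; 5; 3; 1; 0]%N)
    (sp [:: 23; 19; 18; 16; 15; 12; 8; 6; 5; 4; 3; 2]%N)
    (sp [:: 31; 28; 26; 25; 21; 18; 17; 16; 13; 12; 7; 5; 3; 2]%N)
    (sp [:: 29; 25; 23; 18; 17; 16; 15; 13; 12; 11; 10; 9; 8; 7; 6; 2; 1; 0]%N) by sp_mx.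
have VV : letter_mx (true, true) *m letter_mx (false, true) =
  mx2 (sp [:: 23; 22; 19; 18; 15; 12; 11; 10; 9; 8; 5; 3; 1; 0]%N)
    (sp [:: 29; 28; 27; 26; 24; 22; 21; 19; 16; 14; 13; 11; 8; 7; 3; 2]%N)
    (sp [:: 25; 24; 22; 21; 20; 19; 17; 16; 15; 13; 11; 10; 9; 7; 6; 4; 3; 2]%N)
    (sp [:: 29; 25; 23; 18; 17; 16; 15; 13; 12; 11; 10; 9; 8; 7; 6; 2; 1; 0]%N) by sp_mx.
rewrite /= mulmx1 mulmxA BA VV -sp0; sp_mx.
Qed.

Lemma size_comm_eig : size comm_eig0 = 61%N /\ size comm_eig1 = 49%N.
Proof. by rewrite !size_sp. Qed.

Lemma det_word_mx_neq0 u : \det (word_mx u) != 0.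
Proof.
elim: u => [|s u IHu] /=; first by rewrite det1 oner_eq0.
rewrite det_mulmx mulf_neq0 //; apply: contra_neq (letter_den_neq0 s.1).
move=> det0; have /(congr1 determinant) := letter_mxV s.
rewrite det_mulmx det0 mul0r det_scalar => /esym/eqP.
by rewrite !expf_eq0 /= => /eqP.
Qed.

Lemma word_mx_diag_neq0 u :
  word_mx u 0 1 = 0 \/ word_mx u 1 0 = 0 ->
  word_mx u 0 0 != 0 /\ word_mx u 1 1 != 0.
Proof.
move=> u_eq0; have := det_word_mx_neq0 u.
rewrite [word_mx u]mx2E det_mx2_eq !mxE /=.
have -> : word_mx u 0 1 * word_mx u 1 0 = 0.
  by case: u_eq0 => ->; rewrite ?mul0r ?mulr0.
by rewrite subr0 mulf_eq0 negb_or => /andP.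
Qed.

(** The vector [delta_mx 0 0] represents infinity; in [par_fix1], [delta_mx 1 0] represents 0. *)
Lemma par_fix0 (M : 'M_2) : M 1 0 = 0 -> M 0 0 != 0 ->
  par (M *m delta_mx 0 0) (delta_mx 0 0).
Proof.
move=> M10 M00; exists 1, (M 0 0); rewrite oner_eq0 scale1r M00; split=> //.
by apply: cV2P; rewrite ?mulmx2_v0 ?mulmx2_v1 !mxE /= ?M10 ?mul0r ?mulr0 ?addr0.
Qed.

Lemma par_fix1 (M : 'M_2) : M 0 1 = 0 -> M 1 1 != 0 ->
  par (M *m delta_mx 1 0) (delta_mx 1 0).
Proof.
move=> M01 M11; exists 1, (M 1 1); rewrite oner_eq0 scale1r M11; split=> //.
by apply: cV2P; rewrite ?mulmx2_v0 ?mulmx2_v1 !mxE /= ?M01 ?mul0r ?mulr0 ?add0r.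
Qed.

(* The words [abAB] and [baBA] are the itineraries of infinity and of 0. *)
Lemma peripheral_word (G : groupType) (f : bool -> G) u :
    word_mx u 0 1 = 0 \/ word_mx u 1 0 = 0 ->
  exists k l, ev f u =
    (ev f (comm_word false true) ^+ k / ev f (comm_word false true) ^+ l)%g.
Proof.
move=> u_eq0; have [u00 u11] := word_mx_diag_neq0 u_eq0.
have ev_ba : ev f (comm_word true false) = (ev f (comm_word false true))^-1%g.
  by rewrite /ev /= !mulg1 !invgM !invgK !mulgA.
have [w0 w1] : comm_eig0 != 0 /\ comm_eig1 != 0.
  by rewrite -!size_poly_eq0 !size_sp.
case: u_eq0 => u_eq0; last first.
  apply: (@fixed_point_stab G f _ _ _ _ (delta_mx 0 0)) => //.
  - by rewrite cV2_eq0 !mxE oner_eq0.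
  - by rewrite /in_region !mxE /= size_poly1 size_poly0.
  - by rewrite comm_ab_mx; apply: par_fix0; rewrite !mxE.
  - exact: par_fix0.
have [||||] := @fixed_point_stab G f (true, false) (false, false) (true, true)
    (false, true) (delta_mx 1 0) u isT isT.
- by rewrite cV2_eq0 !mxE oner_eq0 andbF.
- by rewrite /in_region !mxE /= size_poly1 size_poly0.
- by rewrite comm_ba_mx; apply: par_fix1; rewrite !mxE.
- exact: par_fix1.
(* The itinerary of 0 spells the inverse commutator, so the two exponents trade places. *)
move=> k [l]; rewrite -/(comm_word true false) ev_ba => ->; exists l, k.
rewrite !expVgn invgK; apply/commute_sym/commuteV/commuteX2/commute_refl.
Qed.

(** * Ping-pong in the degree of [y] *)

Section Amalgam.
Variable R : idomainType.
Implicit Types (M : 'M[R]_2) (b : bool) (v : 'cV[{poly R}]_2) (x : bool * 'M[R]_2).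

(* For [b = true] this is [y T M T^-1] with [T = diag(1, y)]. *)
Definition side_mx b M : 'M[{poly R}]_2 :=
  if b then mx2 ((M 0 0)%:P * 'X) (M 0 1)%:P ((M 1 0)%:P * 'X^2) ((M 1 1)%:P * 'X)
  else mx2 (M 0 0)%:P (M 0 1)%:P (M 1 0)%:P (M 1 1)%:P.

Definition offdiag M := (M 0 1 != 0) && (M 1 0 != 0).

Definition dominated b k v :=
  let m := size (v 0 0) in let n := size (v 1 0) in
  (if b then (m < n) && (n == k) else (n <= m) && (m == k))%N.

(** The dominant coordinate is passed to the other one by a nonzero off-diagonal entry: [M 0 1]
    keeps its degree in y, while [M 1 0] times [y^2] raises it by 2 and outruns every other term. *)
Lemma dominated_side_mx b M k v :
    offdiag M -> (0 < k)%N -> dominated (~~ b) k v ->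
  dominated b (k + b.*2)%N (side_mx b M *m v).
Proof.
case/andP=> M01 M10 k_gt0; rewrite /dominated mulmx2_v0 mulmx2_v1.
have [] := size_add_cases (side_mx b M 0 0 * v 0 0) (side_mx b M 0 1 * v 1 0).
have [] := size_add_cases (side_mx b M 1 0 * v 0 0) (side_mx b M 1 1 * v 1 0).
move: (size (_ * _ + _ * _ : {poly R})) => y.
move: (size (_ * _ + _ * _ : {poly R})) => x.
rewrite !size_mulE; move: (size (v 0 0)) (size (v 1 0)) => m n.
case: b; rewrite /side_mx !mxE /= ?size_mulE ?size_polyC ?size_polyX ?size_polyXn.
all: rewrite M01 M10 /=; case: (m =P 0%N) => ?; case: (n =P 0%N) => ?.
all: case: (M 0 0 == 0); case: (M 1 1 == 0) => /=; lia.
Qed.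

Definition amalg_mx (l : seq (bool * 'M[R]_2)) : 'M[{poly R}]_2 :=
  foldr (fun x N => side_mx x.1 x.2 *m N) 1%:M l.

Definition alternating (T : Type) := sorted (fun x y : bool * T => x.1 != y.1).

Lemma alternating_head (T : Type) b (s t : T) l :
  alternating ((b, s) :: l) = alternating ((b, t) :: l).
Proof. by case: l. Qed.

Lemma amalg_growth x l :
    alternating (x :: l) -> all (fun x => offdiag x.2) (x :: l) ->
  exists i : 'I_2,
    dominated x.1 (count fst (x :: l)).*2.+1 (amalg_mx (x :: l) *m delta_mx i 0).
Proof.
elim: l x => [|z l IHl] x.
  (* The starting basis vector is the one dominated on the side opposite to the last syllable. *)
  rewrite /= andbT => _ offM; exists (if x.1 then 0 else 1).
  rewrite mulmx1 addn0; case: x offM => b M /= offM.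
  rewrite -[X in dominated _ X]/(1 + b.*2)%N.
  apply: dominated_side_mx => //; rewrite /dominated !mxE.
  by case: b; rewrite /= ?size_poly0 ?size_poly1.
rewrite [alternating _]/= => /andP[xz alt_l] /= /andP[off_x off_l].
have [i dom_i] := IHl z alt_l off_l; exists i; rewrite -mulmxA.
have -> : ((x.1 + count fst (z :: l)).*2.+1 = (count fst (z :: l)).*2.+1 + x.1.*2)%N by lia.
apply: dominated_side_mx => //.
suff -> : ~~ x.1 = z.1 by [].
by move: xz; case: x.1 z.1 => [] [].
Qed.

(* Clearing [y] from the denominators multiplies by [y] once for each syllable
   of the second factor, while the leading entry gains a factor [y^2]. *)
Lemma amalg_not_scalar l (c : {poly R}) :
    l != [::] -> alternating l -> all (fun x => offdiag x.2) l ->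
  size c = (count fst l).+1 -> amalg_mx l != c%:M.
Proof.
case: l => // x l _ alt_l off_l size_c; apply/eqP=> eq_c.
have [i] := amalg_growth alt_l off_l.
rewrite eq_c mul_scalar_mx /dominated !mxE !size_mulE size_c.
(* A single syllable of the first factor involves no y; it is excluded by its off-diagonal entry
   instead of by growth. *)
case: l => [|z l] in alt_l off_l size_c eq_c *.
  case: x => [[] M] in alt_l off_l size_c eq_c *.
    by case: (ord2P i) => ->; rewrite /= ?size_poly0 ?size_poly1.
  move: eq_c off_l; rewrite /amalg_mx /= mulmx1 mx2_scalar andbT => /matrixP/(_ 0 1).
  by rewrite !mxE /= => /eqP; rewrite polyC_eq0 /offdiag => ->.
(* Two alternating syllables include one from the second factor, and then [2n + 1] exceeds
   [n + 1]. *)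
have : (0 < count fst (x :: z :: l))%N.
  by move: alt_l; rewrite /=; case: x.1 z.1 => [] [].
move: (count fst _) => n n_gt0.
case: (ord2P i) => -> /=; rewrite ?size_poly0 ?size_poly1; case: x.1 => /=; lia.
Qed.

End Amalgam.

(** * The representation *)

Section PresentedMorphism.
Variables (I : choiceType) (rels : seq (word I * word I)).
Local Open Scope group_scope.

Lemma ev_pres_gen u : ev (@pres_gen I rels) u = \pi_(presented rels)%qT u.
Proof.
elim: u => [|[i b] u IHu] //=.
rewrite -cat1s pi_presM IHu; congr pres_mul.
by case: b; rewrite // /pres_gen -[LHS]pi_presV.
Qed.

Variables (G : groupType) (f : I -> G).
Hypothesis f_rels : forall l r, (l, r) \in rels -> ev f l = ev f r.

Lemma pres_cong_ev u v : pres_cong rels u v -> ev f u = ev f v.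
Proof.
elim=> // {u v}.
- by move=> u v w _ -> _ ->.
- by move=> u u' v v' _ eq_u _ eq_v; rewrite !ev_cat eq_u eq_v.
- by move=> s; rewrite ev_cons ev_letterV mulgV.
Qed.

Lemma ev_repr u : ev f (repr (\pi_(presented rels)%qT u)) = ev f u.
Proof. exact/pres_cong_ev/pres_repr. Qed.

End PresentedMorphism.

Lemma ev_map (G : groupType) (I J : Type) (h : I -> J) (f : J -> G) (u : word I) :
  ev f [seq (h s.1, s.2) | s <- u] = ev (f \o h) u.
Proof. by elim: u => //= s u ->. Qed.

(** * Embedding F_2[x] in F_2(x, y) and clearing denominators *)

Definition x_emb (p : {poly 'F_2}) : F2xy := FracField.tofrac p%:P.
HB.instance Definition _ := GRing.RMorphism.copy x_emb (@FracField.tofrac _ \o polyC).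

Lemma x_emb_eq0 p : (x_emb p == 0) = (p == 0).
Proof. by rewrite tofrac_eq0 polyC_eq0. Qed.

Lemma x_emb_inj : injective x_emb.
Proof. by move=> p q /eqP; rewrite tofrac_eq => /eqP/polyC_inj. Qed.

Section SparseEval.
Variables (K : fieldType) (phi : {rmorphism {poly 'F_2} -> K}).
Hypothesis phi_inj : injective phi.

(* These evaluations reduce to the shape in which the entries of [matA] and
   [matB] are written. *)
Definition sp_term (x : K) (i : nat) : K :=
  match i with 0 => 1 | 1 => x | _ => x ^+ i end.
Definition sp_eval (x : K) (s : seq nat) : K :=
  if s is i :: s' then foldl (fun a j => a + sp_term x j) (sp_term x i) s' else 0.
Definition sp_prod (x : K) (t : seq (seq nat)) : K :=
  if t is s :: t' then foldl (fun a r => a * sp_eval x r) (sp_eval x s) t' else 1.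

Lemma phi_sp s : phi (sp s) = sp_eval (phi 'X) s.
Proof.
have termE i : sp_term (phi 'X) i = phi 'X ^+ i by case: i => [|[]].
case: s => [|i s] /=; first by rewrite sp0 rmorph0.
rewrite /sp big_cons rmorphD rmorphXn -termE.
elim: s (sp_term _ i) => [|j s IHs] z; first by rewrite big_nil rmorph0 addr0.
by rewrite big_cons rmorphD rmorphXn addrA -termE IHs.
Qed.

(** Cross-multiplication moves an identity between fractions back to F_2[x], where [eq_sp] decides
    it. *)
Lemma phi_frac (s : seq nat) (t : seq (seq nat)) (d r : {poly 'F_2}) :
    \prod_(q <- t) sp q != 0 -> d * sp s = r * \prod_(q <- t) sp q ->
  phi d * (sp_eval (phi 'X) s / sp_prod (phi 'X) t) = phi r.
Proof.
have -> : sp_prod (phi 'X) t = phi (\prod_(q <- t) sp q).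
  case: t => [|q t]; rewrite /sp_prod ?big_nil ?rmorph1 // big_cons rmorphM -phi_sp.
  elim: t (phi (sp q)) => [|p t IHt] z.
    by rewrite big_nil rmorph1 mulr1.
  by rewrite [foldl _ _ _]/= big_cons rmorphM mulrA -phi_sp IHt.
move=> t0 eq_r; rewrite -phi_sp mulrA -rmorphM eq_r rmorphM mulfK //.
by rewrite -(rmorph0 phi) (inj_eq phi_inj).
Qed.

Lemma phi_pol (s : seq nat) (d r : {poly 'F_2}) :
  d * sp s = r -> phi d * sp_eval (phi 'X) s = phi r.
Proof. by move=> <-; rewrite rmorphM phi_sp. Qed.

End SparseEval.

Lemma sp_neq0 n s : all (gtn n) s -> sp (n :: s) != 0.
Proof. by move=> sn; rewrite -size_poly_eq0 size_sp. Qed.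

Definition gen_mx (i : bool) : 'M[F2xy]_2 := if i then matB else matA.

Ltac frac_entry s t :=
  let H := fresh in
  have H := @phi_frac _ x_emb x_emb_inj s t;
  rewrite /sp_prod /sp_eval /= in H;
  apply: H;
  [ rewrite ?big_cons big_nil ?mulf_neq0 ?sp_neq0 ?oner_eq0 //
  | rewrite ?big_cons big_nil mulr1 ?mulrA !spM;
    apply: (@eq_sp 64); vm_compute; reflexivity ].

Ltac pol_entry s :=
  let H := fresh in
  have H := @phi_pol _ x_emb s;
  rewrite /sp_eval /= in H;
  apply: H; rewrite spM; apply: (@eq_sp 64); vm_compute; reflexivity.

Lemma gen_mx_clear i :
  x_emb (letter_den i) *: gen_mx i = map_mx x_emb (letter_mx (i, false)).
Proof.
case: i; rewrite /gen_mx /letter_mx /letter_den /matA /matB /At /Bt mx2_scale map_mx2;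
  congr mx2.
+ frac_entry [:: 8; 7; 2]%N [:: [:: 7; 2; 0]; [:: 5; 0]]%N.
+ frac_entry [:: 12; 10; 9; 5; 4; 2; 0]%N [:: [:: 7; 2; 0]; [:: 5; 0]; [:: 2; 1; 0]]%N.
+ pol_entry [:: 2; 1; 0]%N.
+ pol_entry [:: 2]%N.
+ frac_entry [:: 8; 7; 5; 4; 3]%N [:: [:: 6; 5; 0]]%N.
+ frac_entry [:: 13; 11; 2; 1; 0]%N [:: [:: 6; 5; 0]; [:: 5; 0]; [:: 2; 1; 0]]%N.
+ pol_entry [:: 0]%N.
+ frac_entry [:: 3]%N [:: [:: 5; 0]; [:: 2; 1; 0]]%N.
Qed.

Section FieldMx.
Variable K : fieldType.

Lemma invmx_unique n (A B : 'M[K]_n) : A *m B = 1%:M -> invmx A = B.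
Proof.
move=> AB; have [Au _] := mulmx1_unit AB.
by rewrite -[LHS]mulmx1 -AB mulKmx.
Qed.

Lemma invmx_conj n (T A : 'M[K]_n) : T \in unitmx -> A \in unitmx ->
  invmx (T *m A *m invmx T) = T *m invmx A *m invmx T.
Proof.
move=> Tu Au; apply: invmx_unique.
by rewrite !mulmxA mulmxKV // -(mulmxA T) mulmxV // mulmx1 mulmxV.
Qed.

Lemma invmx_clear n (d : K) (A A' B' : 'M[K]_n) :
  d != 0 -> d *: A = A' -> A' *m B' = (d ^+ 2)%:M -> d *: invmx A = B'.
Proof.
move=> d0 dA AB; suff -> : invmx A = d^-1 *: B' by rewrite scalerA mulfV ?scale1r.
apply: invmx_unique; rewrite -[A]scale1r -(mulVf d0) -scalerA dA.
rewrite -scalemxAl -scalemxAr AB !scale_scalar_mx; congr _%:M.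
by rewrite expr2 mulKf ?mulVf.
Qed.

Lemma diag1_unit (t : K) : t != 0 -> mx2 1 0 0 t \in unitmx.
Proof. by move=> t0; rewrite unitmxE det_mx2_eq mul1r mul0r subr0 unitfE. Qed.

Lemma conj_diag_mx2 (t p q r s : K) : t != 0 ->
  mx2 1 0 0 t *m mx2 p q r s *m invmx (mx2 1 0 0 t) = mx2 p (q / t) (t * r) s.
Proof.
move=> t0; have -> : invmx (mx2 1 0 0 t) = mx2 1 0 0 t^-1.
  apply: invmx_unique; rewrite mx2_mul mx2_scalar.
  by rewrite !mul1r !mul0r !mulr0 !addr0 add0r mulfV.
rewrite !mx2_mul !(mul0r, mulr0, mul1r, mulr1, addr0, add0r).
by rewrite [t * s]mulrC mulfK.
Qed.

Lemma side_mx_conj (R : idomainType) (phi : {rmorphism {poly R} -> K}) (M : 'M[R]_2) :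
    phi 'X != 0 ->
  phi 'X *: (mx2 1 0 0 (phi 'X) *m map_mx (phi \o polyC) M *m invmx (mx2 1 0 0 (phi 'X)))
    = map_mx phi (side_mx true M).
Proof.
move=> t0; rewrite [M in LHS]mx2E map_mx2 conj_diag_mx2 // mx2_scale map_mx2 /=.
rewrite !rmorphM; congr mx2; first exact: mulrC.
- by rewrite mulrC divfK.
- by rewrite [RHS]mulrC mulrA.
- exact: mulrC.
Qed.

End FieldMx.

Lemma map_mul_letter_mx s :
  map_mx x_emb (letter_mx s) *m map_mx x_emb (letter_mx (letterV s))
    = (x_emb (letter_den s.1) ^+ 2)%:M.
Proof. by rewrite -map_mxM letter_mxV map_scalar_mx rmorphXn. Qed.

Lemma det_gen_mx i : \det (gen_mx i) = 1.
Proof.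
have d0 : x_emb (letter_den i) ^+ 2 != 0.
  by rewrite expf_neq0 // x_emb_eq0 letter_den_neq0.
apply: (mulfI d0); rewrite mulr1 -detZ gen_mx_clear det_map_mx -rmorphXn.
congr x_emb; case: i {d0}; rewrite /letter_mx /letter_den /At /Bt det_mx2_eq oppF2.
  by rewrite expr2 !spM spD; apply: (@eq_sp 64); vm_compute.
by rewrite expr2 !spM spD; apply: (@eq_sp 64); vm_compute.
Qed.

Lemma ry_neq0 : ry != 0.
Proof. by rewrite tofrac_eq0 polyX_eq0. Qed.

Lemma matT_unit : matT \in unitmx.
Proof. exact/diag1_unit/ry_neq0. Qed.

(** On the conjugated side, [i = false] gives D and [i = true] gives C, so the same word [comm_ab]
    spells both sides of the relation. *)
Definition side_gen (b i : bool) : 'M[F2xy]_2 :=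
  if b then matT *m gen_mx i *m invmx matT else gen_mx i.

Lemma det_side_gen b i : \det (side_gen b i) == 1.
Proof.
case: b; rewrite /side_gen ?det_gen_mx //.
by rewrite !det_mulmx det_gen_mx mulr1 -det_mulmx mulmxV ?matT_unit ?det1.
Qed.

Definition side_SL b i : SL 2 F2xy := MkSL (det_side_gen b i).

Lemma SLval_inj (K : fieldType) n : injective (@SLval n K).
Proof. exact: val_inj. Qed.

Lemma SLvalM (K : fieldType) n (A B : SL n K) : SLval (A * B)%g = SLval A *m SLval B.
Proof. by []. Qed.

Lemma SLvalV (K : fieldType) n (A : SL n K) : SLval A^-1%g = invmx (SLval A).
Proof. by []. Qed.

Lemma letter_clear s :
  x_emb (letter_den s.1) *: SLval (if s.2 then (side_SL false s.1)^-1 else side_SL false s.1)%g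
    = map_mx x_emb (letter_mx s).
Proof.
case: s => i []; last exact: gen_mx_clear.
apply: invmx_clear (gen_mx_clear i) _.
  by rewrite x_emb_eq0 letter_den_neq0.
exact: (map_mul_letter_mx (i, false)).
Qed.

Lemma ev_side_clear u : exists2 d, d != 0 &
  x_emb d *: SLval (ev (side_SL false) u) = map_mx x_emb (word_mx u).
Proof.
elim: u => [|s u [d d0 IHu]].
  by exists 1; rewrite ?oner_eq0 // rmorph1 scale1r map_mx1.
exists (letter_den s.1 * d); first by rewrite mulf_neq0 ?letter_den_neq0.
rewrite [ev _ _]/= SLvalM [word_mx _]/= map_mxM -IHu -letter_clear.
by rewrite rmorphM -scalemxAr -scalemxAl scalerA mulrC.
Qed.

Lemma ev_side_conj u : SLval (ev (side_SL true) u)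
  = matT *m SLval (ev (side_SL false) u) *m invmx matT.
Proof.
have letter s : SLval (ev (side_SL true) [:: s])
    = matT *m SLval (ev (side_SL false) [:: s]) *m invmx matT.
  rewrite !ev1; case: s => i []; rewrite ?SLvalV //.
  by rewrite (invmx_conj matT_unit) // (SL_unit (side_SL false i)).
elim: u => [|s u IHu]; first by rewrite /= mulmx1 mulmxV ?matT_unit.
rewrite (ev_cons _ s u) (ev_cons _ s u) SLvalM letter IHu [in RHS]SLvalM !mulmxA.
by rewrite mulmxKV ?matT_unit.
Qed.

Definition comm_ab := comm_word false true.

Lemma conj_T (d : {poly 'F_2}) (A : 'M[F2xy]_2) (M : 'M[{poly 'F_2}]_2) :
  x_emb d *: A = map_mx x_emb M ->
  FracField.tofrac (d%:P * 'X) *: (matT *m A *m invmx matT)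
    = map_mx (@FracField.tofrac _) (side_mx true M).
Proof.
move=> dA; have cE : FracField.tofrac (d%:P * 'X) = ry * x_emb d.
  by rewrite rmorphM mulrC.
have dT : x_emb d *: (matT *m A *m invmx matT) = matT *m map_mx x_emb M *m invmx matT.
  by rewrite -dA -scalemxAr -scalemxAl.
rewrite cE -scalerA dT; exact: (side_mx_conj _ ry_neq0).
Qed.

(** The commutator [A, B] is diagonal, hence unchanged by conjugation with the diagonal matrix T. *)
Lemma side_comm b : ev (side_SL b) comm_ab = ev (side_SL false) comm_ab.
Proof.
case: b => //; apply: SLval_inj; rewrite ev_side_conj.
have [d d0] := ev_side_clear comm_ab; rewrite comm_ab_mx map_mx2 rmorph0 => dM.
have xd0 : x_emb d != 0 by rewrite x_emb_eq0.
rewrite -[SLval _]scale1r -(mulVf xd0) -scalerA dM mx2_scale mulr0.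
by rewrite (conj_diag_mx2 _ _ _ _ ry_neq0) mul0r mulr0.
Qed.

(** * Descent to the surface group *)

Definition side_letter (b i : bool) : 'I_4 :=
  if b then (if i then gc else gd) else (if i then gb else ga).

Definition rho_gen (k : 'I_4) : SL 2 F2xy :=
  if k == ga then side_SL false false else if k == gb then side_SL false true
  else if k == gc then side_SL true true else side_SL true false.

Lemma rho_gen_letter b i : rho_gen (side_letter b i) = side_SL b i.
Proof.
by rewrite /rho_gen -!val_eqE; case: b i => [] [] /=; rewrite !inordK.
Qed.

Lemma ev_rho_gen b u : ev (rho_gen \o side_letter b) u = ev (side_SL b) u.
Proof. by elim: u => //= s u ->; rewrite !rho_gen_letter. Qed.

Definition side_word b (u : word bool) : word 'I_4 :=
  [seq (side_letter b s.1, s.2) | s <- u].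

Lemma S2_relE : S2_rel = (side_word false comm_ab, side_word true comm_ab).
Proof. by []. Qed.

Lemma rho_gen_rel l r : (l, r) \in [:: S2_rel] -> ev rho_gen l = ev rho_gen r.
Proof.
rewrite inE S2_relE => /eqP eq_lr.
rewrite (congr1 fst eq_lr : l = _) (congr1 snd eq_lr : r = _) !ev_map !ev_rho_gen.
by rewrite (side_comm true).
Qed.

Definition rho (g : S2) : SL 2 F2xy := ev rho_gen (repr g).

Lemma rho_pi (u : word 'I_4) : rho (\pi_(presented [:: S2_rel])%qT u) = ev rho_gen u.
Proof. exact/ev_repr/rho_gen_rel. Qed.

Lemma rhoM : {morph rho : g h / (g * h)%g}.
Proof.
move=> g h; have [u ->] := presP g; have [v ->] := presP h.
by rewrite -[(_ * _)%g]pi_presM !rho_pi ev_cat.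
Qed.

Lemma rho1 : rho 1%g = 1%g.
Proof. exact: (rho_pi [::]). Qed.

HB.instance Definition _ := isUMagmaMorphism.Build S2 (SL 2 F2xy) rho (rho1, rhoM).

(** * Faithfulness *)

Definition side_ev b (u : word bool) : S2 := ev (@pres_gen _ _ \o side_letter b) u.

Lemma side_evE b u : side_ev b u = \pi_(presented [:: S2_rel])%qT (side_word b u).
Proof. by rewrite -ev_pres_gen /side_word ev_map. Qed.

Lemma rho_side_ev b u : rho (side_ev b u) = ev (side_SL b) u.
Proof. by rewrite side_evE rho_pi /side_word ev_map ev_rho_gen. Qed.

Lemma side_ev_cat b u v : side_ev b (u ++ v) = (side_ev b u * side_ev b v)%g.
Proof. exact: ev_cat. Qed.

Definition S2_comm : S2 := side_ev false comm_ab.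

Lemma side_ev_comm b : side_ev b comm_ab = S2_comm.
Proof.
case: b => //; rewrite /S2_comm !side_evE; apply/esym/pres_piP/pres_rel.
by rewrite S2_relE inE.
Qed.

(** Membership in the amalgamated cyclic subgroup, an integer exponent being a difference of two
    natural numbers. *)
Definition comm_quot (g : S2) := exists k l, g = (S2_comm ^+ k / S2_comm ^+ l)%g.

Lemma comm_quotM g h : comm_quot g -> comm_quot h -> comm_quot (g * h)%g.
Proof.
move=> [k [l ->]] [m [n ->]]; exists (k + m)%N, (n + l)%N.
rewrite !expgnDr invgM !mulgA; congr (_ * _)%g; rewrite -!mulgA; congr (_ * _)%g.
exact/commute_sym/commuteV/commuteX2/commute_refl.
Qed.

Lemma side_ev_peripheral b u : ~~ offdiag (word_mx u) -> comm_quot (side_ev b u).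
Proof.
rewrite negb_and !negbK => u_eq0.
have [|k [l ev_u]] := @peripheral_word S2 (@pres_gen _ _ \o side_letter b) u.
  by case/orP: u_eq0 => /eqP; [left | right].
by exists k, l; rewrite /side_ev ev_u -/(side_ev b comm_ab) side_ev_comm.
Qed.

Definition rep_word (n : nat) (w : word bool) : word bool := flatten (nseq n w).

Lemma ev_rep_word (G : groupType) (f : bool -> G) n w :
  ev f (rep_word n w) = (ev f w ^+ n)%g.
Proof.
by elim: n => //= n IHn; rewrite -/(rep_word _ _) ev_cat IHn expgS.
Qed.

Lemma word_mx_rep_word n w a b : word_mx w = mx2 a 0 0 b ->
  word_mx (rep_word n w) = mx2 (a ^+ n) 0 0 (b ^+ n).
Proof.
move=> w_ab; elim: n => [|n IHn]; first by rewrite -mx2_scalar.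
rewrite /rep_word /= word_mx_cat -/(rep_word _ _) IHn w_ab mx2_mul !exprS.
by rewrite !mul0r !mulr0 !addr0 add0r.
Qed.

(** Powers of the commutator as words, so that they can be absorbed into a neighbouring syllable. *)
Definition quot_word (k l : nat) : word bool :=
  rep_word k comm_ab ++ rep_word l (comm_word true false).

Lemma side_ev_quot_word b k l : side_ev b (quot_word k l) = (S2_comm ^+ k / S2_comm ^+ l)%g.
Proof.
rewrite side_ev_cat /side_ev !ev_rep_word -!/(side_ev _ _) side_ev_comm.
congr (_ * _)%g; rewrite -expVgn -(side_ev_comm b); congr (_ ^+ _)%g.
by rewrite /side_ev /ev /= !mulg1 !invgM !invgK !mulgA.
Qed.

Lemma word_mx_quot_word k l : word_mx (quot_word k l)
  = mx2 (comm_eig0 ^+ k * comm_eig1 ^+ l) 0 0 (comm_eig1 ^+ k * comm_eig0 ^+ l).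
Proof.
rewrite word_mx_cat (word_mx_rep_word _ comm_ab_mx) (word_mx_rep_word _ comm_ba_mx).
by rewrite mx2_mul !mul0r !mulr0 !addr0 add0r.
Qed.

Lemma comm_eig_neq0 : comm_eig0 != 0 /\ comm_eig1 != 0.
Proof. by rewrite !sp_neq0. Qed.

Lemma offdiag_quot_word_cat k l u :
  offdiag (word_mx (quot_word k l ++ u)) = offdiag (word_mx u).
Proof.
have [e0 e1] := comm_eig_neq0.
rewrite word_mx_cat word_mx_quot_word [word_mx u]mx2E mx2_mul /offdiag !mxE /=.
by rewrite !mul0r add0r addr0 !mulf_eq0 !expf_eq0 (negPf e0) (negPf e1) !andbF.
Qed.

Lemma offdiag_cat_quot_word k l u :
  offdiag (word_mx (u ++ quot_word k l)) = offdiag (word_mx u).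
Proof.
have [e0 e1] := comm_eig_neq0.
rewrite word_mx_cat word_mx_quot_word [word_mx u]mx2E mx2_mul /offdiag !mxE /=.
by rewrite !mulr0 add0r addr0 !mulf_eq0 !expf_eq0 (negPf e0) (negPf e1) !andbF !orbF.
Qed.

Definition amalg_ev (l : seq (bool * word bool)) : S2 :=
  foldr (fun x g => side_ev x.1 x.2 * g)%g 1%g l.

(** Normal forms of the amalgam, of which only existence is proved. Nonzero off-diagonal entries
    stand in for a syllable lying outside the cyclic subgroup. *)
Definition normal_form (g : S2) :=
  comm_quot g \/
  exists l, [/\ l != [::], alternating l, all (fun x => offdiag (word_mx x.2)) l
    & g = amalg_ev l].

Lemma normal_form_quotM g h : comm_quot g -> normal_form h -> normal_form (g * h)%g.
Proof.
move=> gW [hW|[[|[b u] l] [//= _ alt_l off_l ->]]]; first by left; apply: comm_quotM.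
move: off_l => /andP[off_u off_l].
right; have [k [m ->]] := gW; exists ((b, quot_word k m ++ u) :: l); split=> //.
- by rewrite (alternating_head _ _ u).
- by apply/andP; rewrite offdiag_quot_word_cat.
by rewrite /= side_ev_cat side_ev_quot_word mulgA.
Qed.

Lemma normal_form_sideM b u h : normal_form h -> normal_form (side_ev b u * h)%g.
Proof.
move=> hN; have [off_u|/(side_ev_peripheral b)] := boolP (offdiag (word_mx u)); last first.
  by move=> uW; apply: normal_form_quotM.
case: hN => [[k [m ->]]|[[|[c w] l] [//= _ alt_l off_l ->]]].
  right; exists [:: (b, u ++ quot_word k m)]; split=> //=.
    by rewrite offdiag_cat_quot_word off_u.
  by rewrite side_ev_cat side_ev_quot_word mulg1.
move: off_l => /andP[off_w off_l]; have [eq_bc|neq_bc] := eqVneq b c; last first.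
  right; exists [:: (b, u), (c, w) & l]; split=> //=; last by rewrite off_u off_w.
  by rewrite neq_bc.
rewrite -{c}eq_bc in alt_l *; rewrite mulgA -side_ev_cat.
(* Merging two syllables of one factor may land in the cyclic subgroup; the result is then absorbed
   by the rest of the product. *)
have [off_uw|/(side_ev_peripheral b) uwW] := boolP (offdiag (word_mx (u ++ w))).
  by right; exists ((b, u ++ w) :: l); split; rewrite ?(alternating_head _ _ w) //= off_uw.
apply: normal_form_quotM uwW _; case: l => [|x l] in alt_l off_l *.
  by left; exists 0%N, 0%N; rewrite mulgV.
by right; exists (x :: l); split=> //; case/andP: alt_l.
Qed.

Lemma side_letter_surj (k : 'I_4) : exists b i, k = side_letter b i.
Proof.
case: k => [[|[|[|[|]]]]] // lt_k4; [exists false, false | exists false, true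
  | exists true, true | exists true, false]; by apply: val_inj; rewrite /= inordK.
Qed.

Lemma normal_formP g : normal_form g.
Proof.
have [u ->] := presP g; rewrite -ev_pres_gen; elim: u => [|[k e] u IHu].
  by left; exists 0%N, 0%N; rewrite mulgV.
have [b [i ->]] := side_letter_surj k.
rewrite ev_cons; have -> : ev (@pres_gen _ [:: S2_rel]) [:: (side_letter b i, e)]
  = side_ev b [:: (i, e)] by [].
exact: normal_form_sideM.
Qed.

(** The conjugated side costs one factor y, since conjugation by T divides the upper right entry by
    y. *)
Lemma ev_side_clear_y (b : bool) u : exists2 c : {poly {poly 'F_2}}, size c = b.+1 &
  FracField.tofrac c *: SLval (ev (side_SL b) u)
    = map_mx (@FracField.tofrac _) (side_mx b (word_mx u)).
Proof.
have [d d0 d_clear] := ev_side_clear u; case: b.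
  exists (d%:P * 'X); first by rewrite size_mulX ?polyC_eq0 // size_polyC d0.
  by rewrite ev_side_conj; apply: conj_T.
exists d%:P; first by rewrite size_polyC d0.
by rewrite [LHS]d_clear [word_mx u in LHS]mx2E /side_mx !map_mx2.
Qed.

Lemma amalg_ev_clear l : exists2 c : {poly {poly 'F_2}}, size c = (count fst l).+1 &
  FracField.tofrac c *: SLval (rho (amalg_ev l))
    = map_mx (@FracField.tofrac _) (amalg_mx [seq (x.1, word_mx x.2) | x <- l]).
Proof.
elim: l => [|[b u] l [c size_c IHl]].
  by exists 1; rewrite ?size_poly1 // rmorph1 scale1r rho1 map_mx1.
have [d size_d d_clear] := ev_side_clear_y b u; exists (d * c).
  have [d0 c0] : d != 0 /\ c != 0 by rewrite -!size_poly_eq0 size_d size_c.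
  by rewrite size_mul // size_d size_c /= addnS.
rewrite [amalg_ev _]/= rhoM SLvalM rho_side_ev [map _ _]/= [amalg_mx _]/= map_mxM.
by rewrite -d_clear -IHl rmorphM -scalemxAr -scalemxAl scalerA mulrC.
Qed.

Lemma comm_quot_rho_eq1 g : comm_quot g -> rho g = 1%g -> g = 1%g.
Proof.
move=> [k [l ->]]; rewrite -(side_ev_quot_word false) rho_side_ev => eq1.
have [d _] := ev_side_clear (quot_word k l).
have -> : SLval (ev (side_SL false) (quot_word k l)) = 1%:M by rewrite eq1.
rewrite word_mx_quot_word map_mx2 scale_scalar_mx mx2_scalar mulr1 => /matrixP eq_d.
have /(congr1 (fun p : {poly 'F_2} => size p)) :
    comm_eig0 ^+ k * comm_eig1 ^+ l = comm_eig1 ^+ k * comm_eig0 ^+ l.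
  apply: x_emb_inj; transitivity (x_emb d).
    by have := eq_d 0 0; rewrite !mxE.
  by have := eq_d 1 1; rewrite !mxE.
have [e0 e1] := comm_eig_neq0; have [s0 s1] := size_comm_eig.
have size_pow (p : {poly 'F_2}) n : p != 0 -> size (p ^+ n) = ((size p).-1 * n).+1.
  by move=> p0; rewrite -size_exp prednK // size_poly_gt0 expf_neq0.
rewrite !size_mul ?expf_neq0 // !size_pow // s0 s1 => eq_kl.
(* The degrees give [60k + 48l = 48k + 60l]. *)
have kl : k = l by lia.
by rewrite side_ev_quot_word kl mulgV.
Qed.

Lemma rho_inj : injective rho.
Proof.
apply: gmulf_inj => g rho_g.
have [/comm_quot_rho_eq1|[l [l0 alt_l off_l def_g]]] := normal_formP g; first exact.
have [c size_c] := amalg_ev_clear l.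
rewrite -def_g rho_g scale_scalar_mx mulr1 -map_scalar_mx => eq_c.
(* For [g] in the kernel, the cleared product of its syllables would be the scalar matrix [c], which
   [amalg_not_scalar] forbids. *)
suff /negP[] : amalg_mx [seq (x.1, word_mx x.2) | x <- l] != c%:M.
  apply/eqP/matrixP=> i j; have /matrixP/(_ i j) := eq_c.
  by rewrite !mxE => /eqP; rewrite tofrac_eq => /eqP.
apply: amalg_not_scalar; rewrite ?all_map ?count_map //.
  by rewrite -size_eq0 size_map size_eq0.
by rewrite /alternating sorted_map.
Qed.

Theorem corollary5p5 :
  [/\ \det matA = 1, \det matB = 1, \det matC = 1 & \det matD = 1] /\
  matA *m matB *m invmx matA *m invmx matB =
    matD *m matC *m invmx matD *m invmx matC /\
  exists rho : {multiplicative S2 -> SL 2 F2xy},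
    [/\ SLval (rho S2a) = matA, SLval (rho S2b) = matB,
        SLval (rho S2c) = matC, SLval (rho S2d) = matD
      & injective rho].
Proof.
have det1 b i : \det (side_gen b i) = 1 by apply/eqP/det_side_gen.
split; first by split; [exact: (det1 false false) | exact: (det1 false true)
  | exact: (det1 true true) | exact: (det1 true false)].
split.
  have comm_mx b : SLval (ev (side_SL b) comm_ab) = side_gen b false *m side_gen b true
      *m invmx (side_gen b false) *m invmx (side_gen b true).
    by rewrite ev_comm_word.
  by have := congr1 (@SLval _ _) (side_comm true); rewrite !comm_mx => /esym.
exists rho.
have rhoE b i : SLval (rho (pres_gen _ (side_letter b i))) = side_gen b i.
  by rewrite rho_pi -[[:: _]]/(side_word b [:: (i, false)]) ev_map ev_rho_gen ev1.
split; [exact: (rhoE false false) | exact: (rhoE false true)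
  | exact: (rhoE true true) | exact: (rhoE true false) | exact: rho_inj].
Qed.
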